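(* Let $G=(V,E)$ be a connected graph with countable vertex set, and let $X,Y$ be normed spaces where $X$ is finite-dimensional. Then the following are equivalent: (i) $G$ is $(X,Y)$-flattenable. (ii) Every subgraph of $G$ is $(X,Y)$-flattenable. (iii) $G$ contains a complete tower of connected $(X,Y)$-flattenable subgraphs.
   Context: All normed spaces are real and have dimension greater than zero. Graphs are simple, and here are allowed to have countably infinite vertex and edge sets. For a graph $G=(V,E)$ and a normed space $X$, the measurement map is $f_{G,X}:X^V\to\mathbb{R}^E$, $(x_v)_{v\in V}\mapsto(\|x_v-x_w\|_X)_{vw\in E}$. The graph $G$ is $(X,Y)$-flattenable if $f_{G,X}(X^V)\supseteq f_{G,Y}(Y^V)$. A tower in $G$ is a sequence of finite (non-empty) subgraphs $(G_n)_{n\in\mathbb{N}}$ of $G$, $G_n=(V_n,E_n)$, with $V_n\subseteq V_{n+1}$ and $E_n\subseteq E_{n+1}$ for each $n\in\mathbb{N}$. A tower is complete if $\bigcup_{n\in\mathbb{N}}V_n=V$ and $\bigcup_{n\in\mathbb{N}}E_n=E$. In (iii), each $G_n$ is required to be connected and $(X,Y)$-flattenable. *)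

(* Defs.v *)
From Stdlib Require Import Relation_Operators.
From HB Require Import structures.
From mathcomp Require Import all_boot all_order all_algebra.
From mathcomp Require Import all_classical all_reals all_analysis.
Import Order.TTheory GRing.Theory Num.Theory.
Import numFieldNormedType.Exports.

Set Implicit Arguments.
Unset Strict Implicit.
Unset Printing Implicit Defensive.

Local Open Scope classical_set_scope.
Local Open Scope ring_scope.

(* The vertex set is a subset of an ambient type, so that a graph and its
   subgraphs have the same Rocq type.  The edge vw is represented by the two
   pairs (v, w) and (w, v) of a symmetric irreflexive relation. *)
Record sgraph (T : Type) := SGraph {
  verts : set T;
  adj : T -> T -> Prop;
  adj_sym : forall v w, adj v w -> adj w v;
  adj_irr : forall v, ~ adj v v;
  adj_verts : forall v w, adj v w -> verts v /\ verts w }.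

Definition subgraph T (H G : sgraph T) : Prop :=
  verts H `<=` verts G /\ (forall v w, adj H v w -> adj G v w).

(* The graph with no vertices does not count as connected. *)
Definition connected_graph T (G : sgraph T) : Prop :=
  verts G !=set0 /\
  (forall v w, verts G v -> verts G w -> clos_refl_trans T (adj G) v w).

Definition edges T (G : sgraph T) : set (verts G * verts G) :=
  [set vw | adj G (val vw.1) (val vw.2)].
Arguments edges {T} G _.

(* Each edge contributes two coordinates, (v, w) and (w, v), which are equal
   because the norm is even; inclusions between images are unaffected. *)
Definition measurement (R : realType) (X : normedModType R) T (G : sgraph T)
    (x : verts G -> X) : edges G -> R :=
  fun vw => `|x (val vw).1 - x (val vw).2|.
Arguments measurement {R} X {T} G x _.

Definition flattenable (R : realType) (X Y : normedModType R) T
    (G : sgraph T) : Prop :=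
  range (measurement Y G) `<=` range (measurement X G).

Definition tower T (G : sgraph T) (H : nat -> sgraph T) : Prop :=
  forall n,
    [/\ subgraph (H n) G, verts (H n) !=set0, finite_set (verts (H n))
      & subgraph (H n) (H n.+1)].

Definition complete_tower T (G : sgraph T) (H : nat -> sgraph T) : Prop :=
  [/\ tower G H,
      \bigcup_n verts (H n) = verts G
    & forall v w, (exists n, adj (H n) v w) <-> adj G v w].

Definition finite_dimensional (R : realType) (X : normedModType R) : Prop :=
  exists (n : nat) (b : 'I_n -> X),
    forall x, exists c : 'I_n -> R, x = \sum_(i < n) c i *: b i.

Definition nontrivial (R : realType) (X : normedModType R) : Prop :=
  exists x : X, x != 0.

(* Main.v *)
Require Import Defs.
From Stdlib Require Import Relation_Operators Operators_Properties.
From mathcomp Require Import all_boot all_order all_algebra.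
From mathcomp Require Import all_classical all_reals all_analysis.
Import Order.TTheory GRing.Theory Num.Theory.
Import numFieldNormedType.Exports.

Set Implicit Arguments.
Unset Strict Implicit.
Unset Printing Implicit Defensive.

Local Open Scope classical_set_scope.
Local Open Scope ring_scope.

(** Restricting realizations shows that flattenability passes to subgraphs, and a
    countable connected graph is exhausted by finite connected subgraphs: number
    the vertices, and take the component of a root r in the subgraph induced on
    the vertices numbered at most n ([connected_complete_tower]).  The substance
    is the return from the tower to the whole graph
    ([flattenable_complete_tower]), a compactness argument.

    Fix y in Y^V.  For each n there is a placement x_n in X that gives the edges
    of H_n the lengths prescribed by y, and a translation puts r at the origin.
    A vertex v lies in some H_n and is joined there to r by a path; as this path
    keeps its prescribed edge lengths in all the later placements, x_m(v) stays
    in a fixed ball for m >= n ([path_distance_bound]).  Balls of X are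
    relatively compact because X is finite-dimensional
    ([finite_dimensional_bounded_compact], where a basis of X compares the norm
    of X with the maximum norm of coordinates).  The limit of x_n(v) along one
    nonprincipal ultrafilter on the indices therefore exists for every v; each
    edge has its prescribed length from some index on, so it has that length in
    the limit as well.  The ultrafilter takes the place of a diagonal extraction
    of subsequences over the vertices. *)

(** * Bounded sets in a finite-dimensional normed space *)

(** A spanning family of minimal length is free: a nontrivial relation lets one
    of its vectors be eliminated, which leaves a shorter spanning family. *)
Lemma finite_dimensional_basis (R : realType) (X : normedModType R) :
  finite_dimensional X ->
  exists (n : nat) (b : 'I_n -> X),
    (forall x, exists c : 'I_n -> R, x = \sum_(i < n) c i *: b i) /\
    (forall c : 'I_n -> R, \sum_(i < n) c i *: b i = 0 -> forall i, c i = 0).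
Proof.
move=> [n0 [b0 span0]].
pose spanned n := `[< exists b : 'I_n -> X,
  forall x, exists c : 'I_n -> R, x = \sum_(i < n) c i *: b i >].
have /ex_minnP[n /asboolP[b span] nmin] : exists n, spanned n.
  by exists n0; apply/asboolP; exists b0.
exists n, b; split=> // c c0 k; apply/eqP/negPn/negP => ck.
case: n b span nmin c c0 k ck => [|n] b span nmin c c0 k ck; first by case: k ck.
suff /nmin : spanned n by rewrite ltnn.
apply/asboolP; exists (fun j => b (lift k j)) => x.
have [d dx] := span x.
(* subtracting the right multiple of the relation kills the coefficient at k *)
exists (fun j => d (lift k j) - d k / c k * c (lift k j)).
have -> : x = \sum_i (d i - d k / c k * c i) *: b i.
  under eq_bigr do rewrite scalerBl -scalerA.
  by rewrite sumrB -scaler_sumr c0 scaler0 subr0.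
by rewrite (bigD1_ord k)//= divfK// subrr scale0r add0r.
Qed.

Lemma linear_combination_continuous (R : realType) (X : normedModType R) n
    (b : 'I_n -> X) :
  continuous (fun c : 'rV[R]_n => \sum_(i < n) c 0 i *: b i).
Proof.
apply: continuous_big => [|i _ c]; first exact: add_continuous.
apply: (@cvgZ _ _ _ (nbhs c) _ (fun d : 'rV[R]_n => d 0 i) (fun=> b i)).
  exact: (@coord_continuous R 1 n 0 i c).
exact: cvg_cst.
Qed.

(** On the unit sphere of coordinate space, the norm of a linear combination of
    a free family attains a positive minimum; by homogeneity, coordinates are
    then controlled by the norm of the combination. *)
Lemma coordinates_bounded (R : realType) (X : normedModType R) n
    (b : 'I_n -> X) :
  (forall c : 'I_n -> R, \sum_(i < n) c i *: b i = 0 -> forall i, c i = 0) ->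
  exists2 m : R, 0 < m &
    forall c : 'rV[R]_n, m * `|c| <= `|\sum_(i < n) c 0 i *: b i|.
Proof.
move=> free_b; pose L (c : 'rV[R]_n) := \sum_(i < n) c 0 i *: b i.
pose S := [set c : 'rV[R]_n | `|c| = 1].
have Lcont : continuous L by exact: linear_combination_continuous.
have Lscale a c : L (a *: c) = a *: L c.
  by rewrite /L scaler_sumr; apply: eq_bigr => i _; rewrite mxE scalerA.
have [m m0 minS] : exists2 m : R, 0 < m & forall c, S c -> m <= `|L c|.
  (* the unit sphere is empty when the family is *)
  have [S0|S0] := pselect (S !=set0); last first.
    by exists 1 => // c Sc; exfalso; apply: S0; exists c.
  have Scompact : compact S.
    apply: bounded_closed_compact.
      by exists 1; split=> // M M1 c /= ->; exact: ltW.
    exact: ((continuous_closedP _).1 norm_continuous _ (@closed_eq R 1)).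
  have [|c /set_mem Sc cmin] := compact_EVT_min S0 Scompact (f := fun c => `|L c|).
    apply: continuous_subspaceT => c.
    exact: cvg_norm (Lcont c).
  exists `|L c|; last by move=> d /mem_set; exact: cmin.
  rewrite normr_gt0; apply/eqP => /free_b c0.
  have : c = 0 by apply/rowP => i; rewrite c0 mxE.
  by move=> c00; move: Sc; rewrite /S /= c00 normr0 => /esym/eqP; rewrite oner_eq0.
exists m => // c; have [->|c0] := eqVneq c 0.
  by rewrite normr0 mulr0.
have cpos : 0 < `|c| by rewrite normr_gt0.
have /minS : S (`|c|^-1 *: c).
  by rewrite /S /= normrZ normfV normr_id mulVf// gt_eqF.
rewrite Lscale normrZ normfV normr_id -(ler_pM2r cpos) => /le_trans; apply.
by rewrite mulrAC mulVf ?gt_eqF// mul1r.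
Qed.

(** The coordinates of the vectors of norm at most C fill a bounded set, and the
    compact set is the image of a closed ball of coordinates. *)
Lemma finite_dimensional_bounded_compact (R : realType) (X : normedModType R) :
  finite_dimensional X ->
  forall C : R, exists2 K : set X, compact K & forall x, `|x| <= C -> K x.
Proof.
move=> /finite_dimensional_basis[n [b [span free_b]]] C.
have [m m0 mb] := coordinates_bounded free_b.
pose L (c : 'rV[R]_n) := \sum_(i < n) c 0 i *: b i.
exists (L @` [set c | `|c| <= C / m]).
  apply: continuous_compact.
    by apply: continuous_subspaceT; exact: linear_combination_continuous.
  apply: bounded_closed_compact.
    exists (C / m); split; first exact: num_real.
    by move=> M MC c /= cC; exact: ltW (le_lt_trans cC MC).
  exact: ((continuous_closedP _).1 norm_continuous _ (@closed_le R (C / m))).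
move=> x xC; have [c xc] := span x.
have Lx : L (\row_i c i) = x by rewrite xc; apply: eq_bigr => i _; rewrite mxE.
exists (\row_i c i) => //=.
by rewrite ler_pdivlMr// mulrC (le_trans (mb _))// -[X in `|X|]/(L _) Lx.
Qed.

(** A compact set meets the cluster set of the image of U; an ultrafilter decides
    each preimage of a neighbourhood of a cluster point, and cannot reject it. *)
Lemma ultrafilter_compact_cvg (I : Type) (U : set_system I)
    (T : topologicalType) (K : set T) (f : I -> T) :
  UltraFilter U -> compact K -> U (f @^-1` K) -> exists p : T, f @ U --> p.
Proof.
move=> UU cK UK; have [p [_ fp]] := cK (f @ U) _ UK.
exists p => B Bp; have [//|UB] := in_ultra_setVsetC (f @^-1` B) UU.
by have [z []] := fp (~` B) B UB Bp.
Qed.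

(** * Graph realizations *)

Definition equal_lengths (R : realType) (X Y : normedModType R) T
    (G : sgraph T) (x : T -> X) (y : T -> Y) : Prop :=
  forall v w, adj G v w -> `|x v - x w| = `|y v - y w|.

(** Since the positions of points off the graph do not matter, realizations may
    be taken on the whole ambient type, where a realization of a graph is also,
    without any restriction map, one of each of its subgraphs. *)
Lemma flattenableP (R : realType) (X Y : normedModType R) T (G : sgraph T) :
  flattenable X Y G <->
  forall y : T -> Y, exists x : T -> X, equal_lengths G x y.
Proof.
split=> [fl y | fl _ [y _ <-]].
  have [x _ xy] := fl _ (imageT (measurement Y G) (y \o val)).
  exists (fun v => oapp x 0 (insub v)) => v w vw.
  have [/mem_set Gv /mem_set Gw] := adj_verts vw.
  have Evw : (SigSub Gv, SigSub Gw) \in edges G by apply/mem_set.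
  have := congr1 (fun f => f (SigSub Evw)) xy.
  by rewrite /measurement /= !insubT.
have [x xy] := fl (fun v => oapp y 0 (insub v)).
exists (x \o val) => //; apply/funext => -[[v w] /= vw].
have := xy _ _ (set_mem vw).
by rewrite /measurement /= !valK.
Qed.

Lemma flattenable_subgraph (R : realType) (X Y : normedModType R) T
    (H G : sgraph T) :
  subgraph H G -> flattenable X Y G -> flattenable X Y H.
Proof.
move=> [_ HG] /flattenableP fl; apply/flattenableP => y.
by have [x xy] := fl y; exists x => v w /HG/xy.
Qed.

Lemma path_sym T (G : sgraph T) v w :
  clos_refl_trans T (adj G) v w -> clos_refl_trans T (adj G) w v.
Proof.
elim=> {v w} [v w vw | v | v w u _ wv _ uw].
- by apply: rt_step; exact: adj_sym.
- exact: rt_refl.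
- exact: rt_trans uw wv.
Qed.

(** The triangle inequality along a path: the bound is the length that y gives
    to the path, hence the same for every x with the edge lengths of y. *)
Lemma path_distance_bound (R : realType) (X Y : normedModType R) T
    (G : sgraph T) (y : T -> Y) v w :
  clos_refl_trans T (adj G) v w ->
  exists C : R, forall x : T -> X, equal_lengths G x y -> `|x v - x w| <= C.
Proof.
elim=> {v w} [v w vw | v | v w u _ [C hC] _ [D hD]].
- by exists `|y v - y w| => x ->.
- by exists 0 => x _; rewrite subrr normr0.
- exists (C + D) => x xy.
  by rewrite -(subrKA (x w)) (le_trans (ler_normD _ _))// lerD ?hC ?hD.
Qed.

(** * Towers *)

Lemma tower_le T (G : sgraph T) (H : nat -> sgraph T) m n :
  tower G H -> (m <= n)%N -> subgraph (H m) (H n).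
Proof.
move=> towH; elim: n => [|n IHn]; first by rewrite leqn0 => /eqP ->; split.
rewrite leq_eqVlt => /predU1P[->|/IHn[Vmn Emn]]; first by split.
have [_ _ _ [Vn En]] := towH n.
by split=> [v /Vmn/Vn | v w /Emn/En].
Qed.

(** The limit, along an ultrafilter finer than the filter of final segments, of
    realizations of the graphs of the tower that keep a root r at the origin. *)
Lemma flattenable_complete_tower (R : realType) (X Y : normedModType R) T
    (G : sgraph T) (H : nat -> sgraph T) :
  finite_dimensional X -> complete_tower G H ->
  (forall n, connected_graph (H n) /\ flattenable X Y (H n)) ->
  flattenable X Y G.
Proof.
move=> hfin [towH VH EH] hH; apply/flattenableP => y.
have [_ [r rH0] _ _] := towH 0%N.
have rH n : verts (H n) r by have [+ _] := tower_le towH (leq0n n); exact.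
have /choice[x xP] n : exists x : T -> X, equal_lengths (H n) x y /\ x r = 0.
  have [_ /flattenableP/(_ y)[x xy]] := hH n.
  exists (fun v => x v - x r); rewrite subrr; split=> // v w /xy <-.
  by rewrite opprB addrA subrK.
have xlen n m : (n <= m)%N -> equal_lengths (H n) (x m) y.
  by move=> nm v w; have [_ +] := tower_le towH nm => /[apply]/(xP m).1.
have [U [UU leU]] := ultraFilterLemma (eventually_filter : ProperFilter \oo).
have eventuallyU n (P : set nat) : (forall m, (n <= m)%N -> P m) -> U P.
  by move=> nP; apply: leU; exists n.
have /choice[z zP] v : exists p : X, verts G v -> x n v @[n --> U] --> p.
  have [Gv|nGv] := pselect (verts G v); last by exists 0.
  have [n _ vHn] : (\bigcup_n verts (H n)) v by rewrite VH.
  have [[_ conn] _] := hH n.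
  (* the path is taken in H n, which all later graphs of the tower contain *)
  have [C hC] := @path_distance_bound _ X _ _ _ y _ _ (conn _ _ (rH n) vHn).
  have [K cK KC] := finite_dimensional_bounded_compact hfin C.
  have [|p xp] := @ultrafilter_compact_cvg _ U _ K (x ^~ v) UU cK.
    apply: (eventuallyU n) => m nm; apply: KC.
    by have := hC _ (xlen _ _ nm); rewrite (xP m).2 sub0r normrN.
  by exists p.
exists z => v w vw; have [Gv Gw] := adj_verts vw.
have [n vwHn] := (EH v w).2 vw.
have lim1 : `|x n v - x n w| @[n --> U] --> `|z v - z w|.
  by apply: cvg_norm; apply: cvgB; exact: zP.
have lim2 : `|x n v - x n w| @[n --> U] --> `|y v - y w|.
  by apply: cvg_near_cst; apply: (eventuallyU n) => m nm; exact: xlen vwHn.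
exact: cvg_unique lim1 lim2.
Qed.

(** With f numbering the vertices, this is the component of r in the subgraph
    induced on the vertices numbered at most n.  Taking a component rather than
    the induced subgraph gives connectedness, and costs nothing in the limit. *)
Definition component T (G : sgraph T) (f : T -> nat) (r : T) (n : nat) : set T :=
  [set v | clos_refl_trans T
    (fun u w => [/\ adj G u w, (f u <= n)%N & (f w <= n)%N]) r v].

Lemma component_mono T (G : sgraph T) f r m n :
  (m <= n)%N -> component G f r m `<=` component G f r n.
Proof.
move=> mn v; elim=> {v} [u w [uw um wm] | u | u v w _ uv _ vw].
- by apply: rt_step; split=> //; exact: leq_trans mn.
- exact: rt_refl.
- exact: rt_trans uv vw.
Qed.

Lemma component_sub T (G : sgraph T) f r n :
  verts G r ->
  component G f r n `<=` r |` [set v | verts G v /\ (f v <= n)%N].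
Proof.
move=> Gr v /clos_rt_rtn1_iff; elim=> {v} [|v w [vw _ wn] _ _]; first by left.
by right; split=> //; have [] := adj_verts vw.
Qed.

Definition component_adj T (G : sgraph T) f r n (v w : T) : Prop :=
  [/\ adj G v w, component G f r n v & component G f r n w].

Lemma component_adj_sym T (G : sgraph T) f r n v w :
  component_adj G f r n v w -> component_adj G f r n w v.
Proof. by move=> [vw nv nw]; split=> //; exact: adj_sym. Qed.

Lemma component_adj_irr T (G : sgraph T) f r n v : ~ component_adj G f r n v v.
Proof. by move=> [vv _ _]; exact: adj_irr vv. Qed.

Lemma component_adj_verts T (G : sgraph T) f r n v w :
  component_adj G f r n v w -> component G f r n v /\ component G f r n w.
Proof. by move=> []. Qed.

Definition component_graph T (G : sgraph T) f r n : sgraph T :=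
  SGraph (@component_adj_sym T G f r n) (@component_adj_irr T G f r n)
    (@component_adj_verts T G f r n).

Lemma component_graph_connected T (G : sgraph T) f r n :
  connected_graph (component_graph G f r n).
Proof.
have from_r v : component G f r n v ->
    clos_refl_trans T (component_adj G f r n) r v.
  move=> /clos_rt_rtn1_iff rv.
  elim: rv => {v} [|v w vw rv IH]; first exact: rt_refl.
  apply: rt_trans IH _; apply: rt_step; split; first by case: vw.
    exact/clos_rt_rtn1_iff.
  apply: rt_trans (rt_step _ _ _ _ vw); exact: clos_rtn1_rt.
split=> [|v w /from_r rv /from_r rw]; first by exists r; exact: rt_refl.
apply: rt_trans rw; exact: (@path_sym _ (component_graph G f r n)).
Qed.

(** A path from r has finitely many vertices, so it lies in the subgraph induced
    on the vertices numbered at most n as soon as n is large enough. *)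
Lemma component_exhausts T (G : sgraph T) f r v :
  clos_refl_trans T (adj G) r v -> exists n, component G f r n v.
Proof.
move=> /clos_rt_rtn1_iff rv; elim: rv => {v} [|v w vw _ [n nv]].
  by exists 0%N; exact: rt_refl.
exists (maxn n (maxn (f v) (f w))).
apply: rt_trans (component_mono (leq_maxl _ _) nv) _.
by apply: rt_step; split=> //; rewrite !leq_max leqnn !orbT.
Qed.

Lemma connected_complete_tower T (G : sgraph T) :
  connected_graph G -> countable (verts G) ->
  exists H : nat -> sgraph T,
    complete_tower G H /\ forall n, connected_graph (H n).
Proof.
move=> [[r Gr] conn] /countable_injP[f finj].
exists (component_graph G f r); split; last exact: component_graph_connected.
have subG n : component G f r n `<=` verts G.
  by move=> v /(component_sub Gr)[->|[]].
split.
- move=> n; split=> /=.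
  + by split=> [|v w []] //; exact: subG.
  + by exists r; exact: rt_refl.
  + apply: sub_finite_set (component_sub (n := n) Gr) _.
    rewrite finite_setU; split; first exact: finite_set1.
    rewrite -(@eq_finite_set _ _ (f @` [set v | verts G v /\ (f v <= n)%N])).
      by apply: sub_finite_set (finite_II n.+1) => _ [v [_ fvn] <-].
    apply: inj_card_eq => v w /set_mem[Gv _] /set_mem[Gw _].
    by apply: finj; exact/mem_set.
  + split=> [|v w [vw nv nw]] /=; first exact: component_mono.
    by split=> //; apply: component_mono (leqnSn n) _ _.
- apply/seteqP; split=> [v [n _]|v Gv]; first exact: subG.
  by have [n nv] := component_exhausts f (conn r v Gr Gv); exists n.
- move=> v w; split=> [[n []]//|vw]; have [Gv Gw] := adj_verts vw.
  have [n nv] := component_exhausts f (conn r v Gr Gv).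
  have [m mw] := component_exhausts f (conn r w Gr Gw).
  exists (maxn n m); split=> //.
    exact: component_mono (leq_maxl n m) _ nv.
  exact: component_mono (leq_maxr n m) _ mw.
Qed.

Theorem theorem7p3 (R : realType) (X Y : normedModType R)
  (hX : nontrivial X) (hY : nontrivial Y) (hfin : finite_dimensional X)
  (T : Type) (G : sgraph T)
  (hG : connected_graph G) (hcount : countable (verts G)) :
  [<-> flattenable X Y G;
       forall H : sgraph T, subgraph H G -> flattenable X Y H;
       exists H : nat -> sgraph T,
         complete_tower G H /\
         (forall n, connected_graph (H n) /\ flattenable X Y (H n))].
Proof.
tfae.
- by move=> fl H HG; exact: flattenable_subgraph HG fl.
- move=> fl; have [H [ctH connH]] := connected_complete_tower hG hcount.
  exists H; split=> // n; split; first exact: connH.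
  by apply: fl; case: ctH => /(_ n)[].
- by move=> [H [ctH hH]]; exact: flattenable_complete_tower ctH hH.
Qed.
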